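(* For every integer $N$ there exists a PL $3$-sphere $\mathsf{K}$ with $n\geq N$ vertices such that $\tau(\mathcal{F}(\mathsf{K}))\geq \frac{11}{21}n$.
   Context: A simplicial complex is a PL $d$-sphere if it is PL homeomorphic to the boundary complex of an abstract $(d+1)$-simplex. For a simplicial complex $\mathsf{K}$, the facet hypergraph $\mathcal{F}(\mathsf{K})$ is the hypergraph on the vertex set of $\mathsf{K}$ whose hyperedges are the facets (inclusion-maximal faces) of $\mathsf{K}$. A transversal of a hypergraph $\mathcal{H}$ is a vertex set meeting every hyperedge, and $\tau(\mathcal{H})$ is the minimum size of a transversal. *)

(* Defs.v *)
From mathcomp Require Import all_boot all_order.
From mathcomp Require Import finmap.
From Stdlib Require Import Relations.
Set Implicit Arguments. Unset Strict Implicit. Unset Printing Implicit Defensive.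
Local Open Scope fset_scope.

Definition complex := {fset {fset nat}}.

Definition is_complex (K : complex) : Prop :=
  fset0 \notin K /\
  forall s t : {fset nat}, s \in K -> t `<=` s -> t != fset0 -> t \in K.

Definition verts (K : complex) : {fset nat} := \bigcup_(s <- K) s.

(* Stellar subdivision of K at the face sg, with a new vertex v:
   the open star of sg is removed and replaced by the cone
   v * (boundary sg) * (link sg).  The faces of that cone (together with
   the apex) are the v |` rho with rho `|` sg \in K and sg not inside rho. *)
Definition stellar_sd (K : complex) (sg : {fset nat}) (v : nat) : complex :=
  [fset t in K | ~~ (sg `<=` t)] `|`
  [fset v |` rho | rho in fpowerset (verts K) & (rho `|` sg \in K) && ~~ (sg `<=` rho)].

Definition stellar_move (K L : complex) : Prop :=
  exists (sg : {fset nat}) (v : nat),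
    sg \in K /\ v \notin verts K /\ L = stellar_sd K sg v.

Definition PL_equiv (K L : complex) : Prop :=
  clos_refl_sym_trans complex stellar_move K L.

Definition simplex_boundary (S : {fset nat}) : complex :=
  [fset t in fpowerset S | (t != fset0) && (t != S)].

Definition PL_sphere (d : nat) (K : complex) : Prop :=
  is_complex K /\
  exists S : {fset nat}, #|` S| = d.+2 /\ PL_equiv K (simplex_boundary S).

Definition facets (K : complex) : {fset {fset nat}} :=
  [fset s in K | [forall t : K, (val s `<=` val t) ==> (val t == s)]].

Definition is_transversal (K : complex) (T : {fset nat}) : bool :=
  [forall F : facets K, (T `&` val F != fset0)].

(* tau(F(K)) : minimum size of a transversal of F(K) (transversals are taken
   among subsets of the vertex set; verts K itself is the default value,
   being a transversal whenever all facets are nonempty) *)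
Definition tau_facets (K : complex) : nat :=
  \big[minn/#|` verts K|]_(T <- fpowerset (verts K) | is_transversal K T) #|` T|.

(* Main.v *)
(* A ball with outer tetrahedron F and 17 inner vertices is obtained from F by
   bistellar flips, in such a way that every 9 inner vertices contain a facet of
   the ball: a set that meets all facets has at least 9 vertices inside.  Starting
   from the boundary of a 4-simplex, replace a facet by this ball m times, always
   in a facet of the preceding ball with three of the five initial vertices.  The
   result is PL equivalent to the initial sphere, has 5 + 17 m vertices, and all
   its transversals have at least 9 m elements; 9/17 exceeds 11/21, so m large
   absorbs the constant 5. *)
Require Import Defs.
From mathcomp Require Import all_boot all_order.
From mathcomp Require Import finmap zify.
From Stdlib Require Import Relations.
Local Open Scope fset_scope.

Set Implicit Arguments. Unset Strict Implicit. Unset Printing Implicit Defensive.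

(** * Stellar subdivisions and bistellar flips *)

Lemma in_verts (K : complex) (t : {fset nat}) x : t \in K -> x \in t -> x \in verts K.
Proof. by move=> tK xt; apply/bigfcupP; exists t; rewrite ?andbT. Qed.

Lemma stellar_sdP (K : complex) (A : {fset nat}) v t :
  reflect ((t \in K /\ ~~ (A `<=` t)) \/
           exists2 rho : {fset nat}, t = v |` rho
             & (rho `|` A \in K) && ~~ (A `<=` rho))
          (t \in stellar_sd K A v).
Proof.
rewrite in_fsetU; apply: (iffP orP) => -[].
- by rewrite !inE => /andP[]; left.
- by case/imfsetP=> rho /=; rewrite !inE => /andP[_ h] ->; right; exists rho.
- by case=> tK At; left; rewrite !inE tK.
- case=> rho -> h; right; apply/imfsetP; exists rho => //=.
  rewrite !inE h andbT fpowersetE; apply/fsubsetP=> x xr.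
  by apply: in_verts (proj1 (andP h)) _; rewrite in_fsetU xr.
Qed.

(** The bistellar move from A * bd(B) to bd(A) * B. Only faces containing [B] are added: the others
    of bd(A) * B lie in bd(A) * bd(B), hence already in [K] when the flip is admissible. *)
Definition flip (K : complex) (A B : {fset nat}) : complex :=
  [fset t in K | ~~ (A `<=` t)] `|`
  [fset t in fpowerset (A `|` B) | (B `<=` t) && ~~ (A `<=` t)].

Lemma in_flip (K : complex) (A B t : {fset nat}) :
  (t \in flip K A B) = (t \in K) && ~~ (A `<=` t)
    || [&& t `<=` A `|` B, B `<=` t & ~~ (A `<=` t)].
Proof. by rewrite !inE fpowersetE. Qed.

(** The last clause says that the link of [A] is the boundary of [B]. If [B] is a single new vertex,
    this means that [A] is a facet, so the insertion of a vertex is a flip too. *)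
Definition flippable (K : complex) (A B : {fset nat}) : Prop :=
  [/\ A != fset0, B != fset0, [disjoint A & B]%fset, B \notin K &
    forall t : {fset nat}, A `<=` t ->
      (t \in K) = (t `<=` A `|` B) && ~~ (B `<=` t)].

Lemma disjoint_subU (A B t : {fset nat}) :
  [disjoint A & B]%fset -> (B `<=` t `|` A) = (B `<=` t).
Proof.
move=> dAB; apply/idP/idP => [|h]; last exact: fsubset_trans h (fsubsetUl _ _).
move=> /fsubsetP h; apply/fsubsetP=> x xB; move: (h x xB).
rewrite in_fsetU => /orP[//|xA].
by move/fdisjointP: dAB => /(_ x xA); rewrite xB.
Qed.

Lemma flip_complex (K : complex) (A B : {fset nat}) :
  is_complex K -> flippable K A B -> is_complex (flip K A B).
Proof.
move=> [K0 Kd] [A0 B0 dAB BK hA]; split.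
  by rewrite in_flip (negPf K0) /= fsubset0 (negPf B0) andbF.
move=> s t; rewrite !in_flip => /orP[/andP[sK As] ts t0|/and3P[sAB Bs As] ts t0].
  rewrite (Kd s) //=; apply/orP; left.
  by apply: contra As => h; apply: fsubset_trans h ts.
have At : ~~ (A `<=` t) by apply: contra As => h; apply: fsubset_trans h ts.
have tAB := fsubset_trans ts sAB.
rewrite At tAB !andbT /=; case: (boolP (B `<=` t)) => Bt; first by rewrite orbT.
(* A subset of a new face that lacks [B] is an old face: its union with [A] lies in A * bd(B). *)
rewrite orbF; apply: (Kd (t `|` A)) => //; last exact: fsubsetUl.
by rewrite hA ?fsubsetUr // (disjoint_subU t dAB) Bt fsubUset tAB fsubsetUl.
Qed.

(* Subdividing K at A and the flipped complex at B with the same new vertex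
   yields the same complex. *)
Lemma flip_PL (K : complex) (A B : {fset nat}) :
  is_complex K -> flippable K A B -> PL_equiv K (flip K A B).
Proof.
move=> cK fK; have cL := flip_complex cK fK.
case: (cK) (fK) => [K0 Kd] [A0 B0 dAB BK hA].
have AnB : ~~ (A `<=` B).
  apply: contra A0 => /fsetIidPl AB; rewrite -AB -fsubset0.
  by move: dAB; rewrite /fdisjoint => /eqP->.
have BnA : ~~ (B `<=` A).
  apply: contra B0 => /fsetIidPl AB; rewrite -AB fsetIC -fsubset0.
  by move: dAB; rewrite /fdisjoint => /eqP->.
have nBK t : t \in K -> ~~ (B `<=` t).
  by move=> tK; apply: contra BK => h; apply: Kd tK h B0.
pose v := (\max_(i <- verts K `|` verts (flip K A B)) i).+1.
have vmax x : x \in verts K `|` verts (flip K A B) -> x < v.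
  by move=> xV; rewrite ltnS; apply: (@leq_bigmax_seq _ _ xpredT id x xV isT).
have vK : v \notin verts K.
  by apply/negP=> h; have := vmax v; rewrite in_fsetU h ltnn => /(_ isT).
have vL : v \notin verts (flip K A B).
  by apply/negP=> h; have := vmax v; rewrite in_fsetU h orbT ltnn => /(_ isT).
have AK : A \in K by rewrite hA // BnA fsubsetUl.
have BL : B \in flip K A B by rewrite in_flip fsubsetUr fsubset_refl AnB orbT.
apply: (rst_trans _ _ _ (stellar_sd K A v)); first by apply: rst_step; exists A, v.
apply/rst_sym/rst_step; exists B, v; split=> //; split=> //.
have e1 t : (t \in K /\ ~~ (A `<=` t)) <-> (t \in flip K A B /\ ~~ (B `<=` t)).
  rewrite in_flip; split=> [[tK At]|[h Bt]]; first by rewrite tK At (nBK t tK).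
  by move: h; rewrite (negPf Bt) /= andbF orbF => /andP[].
(* Both cones have base bd(A) * bd(B): each side says that [r] lies in the union of [A] and [B] and
   contains neither of them. *)
have e2 (r : {fset nat}) : ((r `|` A \in K) && ~~ (A `<=` r)) =
    ((r `|` B \in flip K A B) && ~~ (B `<=` r)).
  rewrite hA ?fsubsetUr // (disjoint_subU r dAB) in_flip fsubsetUr /=.
  rewrite (@disjoint_subU B A) 1?fdisjoint_sym // !fsubUset fsubsetUl fsubsetUr !andbT.
  case: (boolP (r `|` B \in K)) => [/nBK|_]; first by rewrite fsubsetUr.
  by rewrite /= -!andbA [X in _ && X]andbC.
apply/fsetP=> t; apply/stellar_sdP/stellar_sdP.
  by case=> [/e1|[r -> h]]; [left | right; exists r; rewrite // -e2].
by case=> [/e1|[r -> h]]; [left | right; exists r; rewrite // e2].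
Qed.

(** * Faces coded as bit sequences *)

Definition bsub (c d : bitseq) : bool := all2 implb c d.
Definition bcup (c d : bitseq) : bitseq := [seq p.1 || p.2 | p <- zip c d].
Definition bdisj (c d : bitseq) : bool := all2 (fun x y => ~~ (x && y)) c d.
Fixpoint bsubs (c : bitseq) : seq bitseq :=
  if c is b :: c' then
    let r := bsubs c' in
    map (cons false) r ++ (if b then map (cons true) r else [::])
  else [:: [::]].

(** The labelling [g] of positions stays abstract, so that one computation on codes transfers to
    every injectively labelled copy. *)
Definition face (g : nat -> nat) (c : bitseq) : {fset nat} :=
  [fset x in [seq g i | i <- iota 0 (size c) & nth false c i]].

Lemma faceP g c x :
  reflect (exists2 i, nth false c i & x = g i) (x \in face g c).
Proof.
rewrite in_fset /=; apply: (iffP mapP) => [[i]|[i ci ->]].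
  by rewrite mem_filter => /andP[ci _] ->; exists i.
exists i => //; rewrite mem_filter ci mem_iota /= add0n.
by case: ltnP => // h; rewrite nth_default in ci.
Qed.

Lemma card_face g c : injective g -> #|` face g c| = count id c.
Proof.
move=> gI; rewrite card_fseq undup_id ?map_inj_uniq ?filter_uniq ?iota_uniq //.
rewrite size_map size_filter -[in RHS](mkseq_nth false c) count_map.
by apply: eq_count.
Qed.

Lemma mem_face g c i : injective g -> (g i \in face g c) = nth false c i.
Proof.
by move=> gI; apply/faceP/idP => [[j cj /gI->]//|ci]; exists i.
Qed.

(** Bits out of range read as [false], so [r false false] lets the index run over all of nat. *)
Lemma all2_nthP (r : rel bool) (c d : bitseq) : r false false -> size c = size d ->
  reflect (forall i, r (nth false c i) (nth false d i)) (all2 r c d).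
Proof.
move=> r0; elim: c d => [|x c IH] [|y d] //= => [_|[/IH {}IH]].
  by apply: ReflectT => i; rewrite !nth_nil.
apply: (iffP andP) => [[rxy /IH h] [|i] //=|h].
by split; [exact: (h 0) | apply/IH => i; exact: (h i.+1)].
Qed.

Lemma face_sub g c d : injective g -> size c = size d ->
  (face g c `<=` face g d) = bsub c d.
Proof.
move=> gI e; apply/fsubsetP/(all2_nthP _ e) => // h => [i|x /faceP[i ci ->]].
  by apply/implyP; rewrite -!(mem_face _ _ gI); apply: h.
by rewrite mem_face //; exact: (implyP (h i)).
Qed.

Lemma face_disj g c d : injective g -> size c = size d -> bdisj c d ->
  [disjoint face g c & face g d]%fset.
Proof.
move=> gI e /(all2_nthP _ e) h; apply/fdisjointP => x /faceP[i ci ->].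
by rewrite mem_face //; move: (h isT i); rewrite ci.
Qed.

Lemma size_bcup c d : size c = size d -> size (bcup c d) = size c.
Proof. by move=> e; rewrite size_map size_zip e minnn. Qed.

Lemma face_cup g c d : injective g -> size c = size d ->
  face g (bcup c d) = face g c `|` face g d.
Proof.
move=> gI e; have nthU i : nth false (bcup c d) i = nth false c i || nth false d i.
  case: (ltnP i (size c)) => h; last by rewrite !nth_default ?size_bcup -?e.
  by rewrite (nth_map (false, false)) ?size_zip -?e ?minnn // nth_zip.
apply/fsetP => x; rewrite in_fsetU; apply/faceP/orP => [[i]|].
  by rewrite nthU => /orP[] h ->; rewrite !mem_face //; [left|right].
by case=> /faceP[i ci ->]; exists i; rewrite // nthU ci ?orbT.
Qed.

Lemma face_eq0 g c : has id c -> face g c != fset0.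
Proof.
move=> /(has_nthP false)[i _ ci]; apply/fset0Pn; exists (g i).
by apply/faceP; exists i.
Qed.

Lemma mem_bsubs c d : (d \in bsubs c) = bsub d c.
Proof.
have inj (b : bool) : injective (cons b) by move=> ? ? [].
elim: c d => [|b c IH] [|x d] //=.
  rewrite mem_cat; apply/negP=> /orP[/mapP[] //|].
  by case: b => // /mapP[].
have no r : (x :: d \in map (cons (~~ x)) r) = false.
  by apply/negP => /mapP[e _ []]; case: x.
rewrite mem_cat; case: x no => no.
  by rewrite no; case: b; rewrite //= (mem_map (inj true)) IH.
by rewrite (mem_map (inj false)) IH; case: b; rewrite ?no ?orbF.
Qed.

Lemma sub_face g c (t : {fset nat}) : t `<=` face g c ->
  exists2 d, d \in bsubs c & t = face g d.
Proof.
move=> /fsubsetP h.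
pose d := [seq nth false c i && (g i \in t) | i <- iota 0 (size c)].
have sd : size d = size c by rewrite size_map size_iota.
have nthd i : nth false d i = nth false c i && (g i \in t).
  case: (ltnP i (size c)) => hi; last by rewrite !nth_default ?sd.
  by rewrite (nth_map 0) ?size_iota // nth_iota.
exists d.
  rewrite mem_bsubs; apply/(@all2_nthP implb _ _ isT sd) => i.
  by rewrite nthd; apply/implyP => /andP[].
apply/fsetP => x; apply/idP/faceP => [xt|[i]].
  by have /faceP[i ci e] := h x xt; exists i; rewrite // nthd ci -e.
by rewrite nthd => /andP[_ ?] ->.
Qed.

(** * Flips inside a ball, carried out on codes *)

(* The complex R together with the faces coded by I; the flips only see I, while
   R is the outside of a ball with vertex set U filling the tetrahedron F. *)
Definition fill g (R : complex) (I : seq bitseq) : complex :=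
  R `|` [fset t in [seq face g c | c <- I]].

Lemma fillP g (R : complex) (I : seq bitseq) t :
  reflect (t \in R \/ exists2 c, c \in I & t = face g c) (t \in fill g R I).
Proof.
rewrite !inE; apply: (iffP orP); case; [by left|by move/mapP; right|by left|].
by move/mapP; right.
Qed.

(** Faces of [R] will meet [U] only in proper subfaces of [F]. Hence [b] not inside [F] keeps [b]
    out of [R], and [a] equal to [F] or not inside it keeps [a] out of every face of [R]. With [R]
    thus excluded, the tests on [I] express [flippable]. *)
Definition flip_code (n : nat) (F U : bitseq) (I : seq bitseq)
    (ab : bitseq * bitseq) : option (seq bitseq) :=
  let: (a, b) := ab in
  let u := bcup a b in
  let s := bsubs u in
  if [&& size a == n, size b == n, has id a, has id b, bdisj a b, bsub u U,
         ~~ bsub b F, (a == F) || ~~ bsub a F,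
         all (fun c => ~~ bsub b c && (bsub a c ==> bsub c u)) I &
         all (fun d => bsub a d && ~~ bsub b d ==> (d \in I)) s]
  then Some ([seq c <- I | ~~ bsub a c]
               ++ [seq d <- s | bsub b d && ~~ bsub a d])
  else None.

Lemma flip_code_PL n F U g R I ab I' :
  injective g -> size F = n -> size U = n ->
  (forall t, t \in R -> t `&` face g U `<` face g F) ->
  all (fun c => size c == n) I -> is_complex (fill g R I) ->
  flip_code n F U I ab = Some I' ->
  [/\ all (fun c => size c == n) I', is_complex (fill g R I') &
    PL_equiv (fill g R I) (fill g R I')].
Proof.
case: ab => a b gI sF sU hR sI cK /=; case: ifP => //.
case/and5P=> /eqP sa /eqP sb a0 b0 /and5P[dab uU bF aF /andP[/allP hI /allP hs]] [<-].
have sab : size a = size b by rewrite sa.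
have su : size (bcup a b) = n by rewrite size_bcup.
have ssub c : c \in bsubs (bcup a b) -> size c = n.
  by rewrite mem_bsubs /bsub all2E su => /andP[/eqP].
have {}sI c : c \in I -> size c = n by move/(allP sI)/eqP.
have RnA t : t \in R -> ~~ (face g a `<=` t).
  move=> /hR; apply: contraTN => At.
  have {}At : face g a `<=` t `&` face g U.
    rewrite fsubsetI At (fsubset_trans _ (_ : face g (bcup a b) `<=` _)) //.
      by rewrite face_cup // fsubsetUl.
    by rewrite face_sub // su.
  apply/negP => /(fsub_proper_trans At); case/orP: aF => [/eqP->|].
    by rewrite (negPf (fproper_irrefl _)).
  by move=> aF /fproper_sub; rewrite face_sub ?sa ?sF // (negPf aF).
have fK : flippable (fill g R I) (face g a) (face g b).
  split; rewrite ?face_eq0 ?face_disj //.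
    apply/fillP => -[bR|[c cI e]].
      have bU : face g b `<=` face g U.
        apply: fsubset_trans (_ : face g (bcup a b) `<=` _).
          by rewrite face_cup // fsubsetUr.
        by rewrite face_sub // su.
      move: (hR _ bR); rewrite (fsetIidPl bU) => /fproper_sub.
      by rewrite face_sub ?sb ?sF // (negPf bF).
    case/andP: (hI c cI) => /negP[]; rewrite -(face_sub gI) ?sb ?sI //.
    by rewrite e fsubset_refl.
  move=> t At; apply/fillP/andP => [[tR|[c cI e]]|[tab Bt]].
  - by move: (RnA t tR); rewrite At.
  - move: At; rewrite e -face_cup // !face_sub ?sa ?sb ?su ?sI // => ac.
    by case/andP: (hI c cI) => -> /implyP->.
  - move: tab; rewrite -face_cup // => /sub_face[d dS e]; right; exists d => //.
    have := hs d dS; rewrite -!(face_sub gI) ?sa ?sb ?ssub // -e At Bt.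
    by move/implyP; apply.
have e : fill g R ([seq c <- I | ~~ bsub a c]
    ++ [seq d <- bsubs (bcup a b) | bsub b d && ~~ bsub a d])
    = flip (fill g R I) (face g a) (face g b).
  apply/fsetP => t; rewrite in_flip -face_cup //; apply/fillP/orP.
    case=> [tR|[c]]; first by left; rewrite RnA // andbT; apply/fillP; left.
    rewrite mem_cat !mem_filter => /orP[/andP[ac cI]|/andP[/andP[bc ac] cS]] ->.
      left; rewrite face_sub ?sa ?sI // ac andbT; apply/fillP; right.
      by exists c.
    right; rewrite !face_sub ?sa ?sb ?su ?ssub // bc ac.
    by rewrite -mem_bsubs cS.
  case=> [/andP[/fillP[tR|[c cI e]] At]|/and3P[/sub_face[d dS ->]]].
  - by left.
  - right; exists c => //; rewrite mem_cat mem_filter cI andbT.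
    by rewrite -(face_sub gI) ?sa ?sI // -e At.
  - rewrite !face_sub ?sa ?sb ?ssub // => bd ad; right; exists d => //.
    by rewrite mem_cat !mem_filter bd ad dS orbT.
split; last first.
- by rewrite e; apply: flip_PL.
- by rewrite e; apply: flip_complex.
apply/allP => c; rewrite mem_cat !mem_filter => /orP[]/andP[_].
  by move/sI/eqP.
by move/ssub/eqP.
Qed.

Fixpoint flip_codes n F U (I : seq bitseq) (l : seq (bitseq * bitseq)) :=
  if l is ab :: l' then obind (flip_codes n F U ^~ l') (flip_code n F U I ab)
  else Some I.

Lemma flip_codes_PL n F U g R l : forall I I',
  injective g -> size F = n -> size U = n ->
  (forall t, t \in R -> t `&` face g U `<` face g F) ->
  all (fun c => size c == n) I -> is_complex (fill g R I) ->
  flip_codes n F U I l = Some I' ->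
  is_complex (fill g R I') /\ PL_equiv (fill g R I) (fill g R I').
Proof.
elim: l => [|ab l IH] I I' gI sF sU hR sI cK /=.
  by case=> <-; split=> //; apply: rst_refl.
case e: flip_code => [J|] //= eJ.
have [sJ cJ hJ] := flip_code_PL gI sF sU hR sI cK e.
have [cI' h] := IH J I' gI sF sU hR sJ cJ eJ.
by split=> //; apply: rst_trans hJ h.
Qed.

(** * Explicit data of the ball *)

(* Found by simulated annealing over the triangulations of the 3-sphere with 17
   vertices.  [core_facets] lists all facets but one of such a sphere; a tube
   without new vertices joins the boundary of the missing facet to that of
   {0, 1, 2, 4}.  Vertex 3 is left to the initial 4-simplex. *)
Definition ball_flips : seq (seq nat * seq nat) := [::
  ([:: 0; 1; 2; 4], [:: 12]); ([:: 0; 1; 2; 12], [:: 21]);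
  ([:: 0; 1; 12; 21], [:: 11]); ([:: 0; 11; 12; 21], [:: 13]);
  ([:: 11; 12; 13; 21], [:: 8]); ([:: 8; 11; 12; 13], [:: 15]);
  ([:: 8; 11; 12; 15], [:: 18]); ([:: 8; 11; 15; 18], [:: 10]);
  ([:: 8; 11; 15], [:: 10; 13]); ([:: 8; 13; 15], [:: 10; 12]);
  ([:: 11; 12; 13], [:: 0; 15]); ([:: 0; 11; 13], [:: 15; 21]);
  ([:: 10; 11; 15], [:: 13; 18]); ([:: 0; 13], [:: 12; 15; 21]);
  ([:: 8; 11; 12], [:: 18; 21]); ([:: 8; 10; 15; 18], [:: 5]);
  ([:: 5; 8; 10; 15], [:: 7]); ([:: 5; 8; 15], [:: 7; 18]);
  ([:: 5; 8; 10; 18], [:: 17]); ([:: 8; 10; 18], [:: 11; 17]);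
  ([:: 5; 10; 18], [:: 15; 17]); ([:: 10; 15; 18], [:: 13; 17]);
  ([:: 8; 10; 15], [:: 7; 12]); ([:: 8; 15], [:: 7; 12; 18]);
  ([:: 8; 11; 18; 21], [:: 14]); ([:: 8; 11; 18], [:: 14; 17]);
  ([:: 11; 17; 18], [:: 10; 14]); ([:: 8; 17; 18], [:: 5; 14]);
  ([:: 10; 13; 17; 18], [:: 6]); ([:: 10; 13; 18], [:: 6; 11]);
  ([:: 10; 14; 17; 18], [:: 16]); ([:: 14; 17; 18], [:: 5; 16]);
  ([:: 6; 10; 13; 17], [:: 9]); ([:: 6; 10; 13], [:: 9; 11]);
  ([:: 10; 17; 18], [:: 6; 16]); ([:: 8; 10; 17], [:: 5; 11]);
  ([:: 6; 10; 17], [:: 9; 16]); ([:: 10; 11; 13], [:: 8; 9]);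
  ([:: 9; 10; 13; 17], [:: 20]); ([:: 9; 10; 17], [:: 16; 20]);
  ([:: 8; 14; 18], [:: 5; 21]); ([:: 5; 14; 18], [:: 16; 21]);
  ([:: 10; 16; 17], [:: 14; 20]); ([:: 8; 10; 11], [:: 5; 9]);
  ([:: 8; 11; 21], [:: 13; 14]); ([:: 5; 14; 17], [:: 8; 16]);
  ([:: 8; 14; 21], [:: 5; 13]); ([:: 10; 13; 15; 17], [:: 19]);
  ([:: 10; 13; 17], [:: 19; 20]); ([:: 12; 15; 18], [:: 7; 11]);
  ([:: 13; 15; 17], [:: 18; 19]); ([:: 10; 13; 19], [:: 15; 20]);
  ([:: 13; 15; 18], [:: 11; 19]); ([:: 16; 21], [:: 5; 14; 18]);
  ([:: 10; 13; 20], [:: 9; 15]); ([:: 5; 8; 10], [:: 7; 9]);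
  ([:: 5; 8; 14], [:: 13; 16]); ([:: 11; 15; 18], [:: 7; 19]);
  ([:: 11; 13; 21], [:: 14; 15]); ([:: 11; 15; 19], [:: 7; 13]);
  ([:: 9; 10; 11], [:: 5; 6]); ([:: 11; 13; 15], [:: 7; 14]);
  ([:: 5; 9; 10], [:: 6; 7]); ([:: 5; 8; 13], [:: 16; 21]);
  ([:: 11; 14; 18], [:: 10; 21]); ([:: 10; 14; 16], [:: 18; 20]);
  ([:: 7; 10; 15], [:: 5; 12]); ([:: 7; 11; 18], [:: 12; 19]);
  ([:: 10; 16; 18], [:: 6; 20]); ([:: 10; 13; 15], [:: 9; 12]);
  ([:: 10; 14; 18], [:: 20; 21]); ([:: 10; 15; 20], [:: 9; 19]);
  ([:: 13; 15; 19], [:: 7; 20]); ([:: 5; 17; 18], [:: 15; 16]);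
  ([:: 9; 13; 15], [:: 12; 20]); ([:: 16; 17; 20], [:: 9; 14]);
  ([:: 7; 12; 18], [:: 8; 19]); ([:: 16; 17; 18], [:: 6; 15]);
  ([:: 14; 16; 20], [:: 9; 18]); ([:: 5; 8; 18], [:: 7; 21]);
  ([:: 15; 18; 19], [:: 7; 17]); ([:: 9; 10; 20], [:: 16; 19]);
  ([:: 5; 8; 21], [:: 7; 16]); ([:: 14; 18; 21], [:: 5; 20]);
  ([:: 11; 13; 18], [:: 6; 19]); ([:: 9; 13; 20], [:: 12; 17]);
  ([:: 8; 13; 21], [:: 12; 16]); ([:: 8; 14; 17], [:: 11; 16]);
  ([:: 10; 15; 17], [:: 5; 19]); ([:: 13; 15; 21], [:: 12; 14]);
  ([:: 5; 7; 9], [:: 6; 8]); ([:: 10; 11; 14], [:: 17; 21]);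
  ([:: 7; 8; 18], [:: 19; 21]); ([:: 9; 16; 17], [:: 6; 14]);
  ([:: 5; 16; 17], [:: 8; 15]); ([:: 11; 18; 19], [:: 6; 12])].

Definition core_facets : seq (seq nat) := [::
  [:: 5; 6; 7; 8]; [:: 5; 6; 7; 10]; [:: 5; 6; 8; 9]; [:: 5; 6; 9; 11];
  [:: 5; 6; 10; 11]; [:: 5; 7; 8; 16]; [:: 5; 7; 10; 12]; [:: 5; 7; 12; 15];
  [:: 5; 7; 15; 18]; [:: 5; 7; 16; 21]; [:: 5; 7; 18; 21]; [:: 5; 8; 9; 11];
  [:: 5; 8; 11; 17]; [:: 5; 8; 15; 16]; [:: 5; 8; 15; 17];
  [:: 5; 10; 11; 17]; [:: 5; 10; 12; 15]; [:: 5; 10; 15; 19];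
  [:: 5; 10; 17; 19]; [:: 5; 13; 14; 16]; [:: 5; 13; 14; 21];
  [:: 5; 13; 16; 21]; [:: 5; 14; 16; 18]; [:: 5; 14; 18; 20];
  [:: 5; 14; 20; 21]; [:: 5; 15; 16; 18]; [:: 5; 15; 17; 19];
  [:: 5; 18; 20; 21]; [:: 6; 7; 8; 9]; [:: 6; 7; 9; 10]; [:: 6; 9; 10; 16];
  [:: 6; 9; 11; 13]; [:: 6; 9; 13; 17]; [:: 6; 9; 14; 16]; [:: 6; 9; 14; 17];
  [:: 6; 10; 11; 18]; [:: 6; 10; 16; 20]; [:: 6; 10; 18; 20];
  [:: 6; 11; 12; 18]; [:: 6; 11; 12; 19]; [:: 6; 11; 13; 19];
  [:: 6; 12; 18; 19]; [:: 6; 13; 17; 18]; [:: 6; 13; 18; 19];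
  [:: 6; 14; 16; 17]; [:: 6; 15; 16; 17]; [:: 6; 15; 16; 18];
  [:: 6; 15; 17; 18]; [:: 6; 16; 18; 20]; [:: 7; 8; 9; 10];
  [:: 7; 8; 10; 12]; [:: 7; 8; 12; 19]; [:: 7; 8; 16; 21]; [:: 7; 8; 19; 21];
  [:: 7; 11; 12; 15]; [:: 7; 11; 12; 19]; [:: 7; 11; 13; 14];
  [:: 7; 11; 13; 19]; [:: 7; 11; 14; 15]; [:: 7; 13; 14; 15];
  [:: 7; 13; 15; 20]; [:: 7; 13; 19; 20]; [:: 7; 15; 17; 18];
  [:: 7; 15; 17; 19]; [:: 7; 15; 19; 20]; [:: 7; 17; 18; 19];
  [:: 7; 18; 19; 21]; [:: 8; 9; 10; 13]; [:: 8; 9; 11; 13];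
  [:: 8; 10; 12; 13]; [:: 8; 11; 13; 14]; [:: 8; 11; 14; 16];
  [:: 8; 11; 16; 17]; [:: 8; 12; 13; 16]; [:: 8; 12; 16; 21];
  [:: 8; 12; 18; 19]; [:: 8; 12; 18; 21]; [:: 8; 13; 14; 16];
  [:: 8; 15; 16; 17]; [:: 8; 18; 19; 21]; [:: 9; 10; 12; 13];
  [:: 9; 10; 12; 15]; [:: 9; 10; 15; 19]; [:: 9; 10; 16; 19];
  [:: 9; 12; 13; 17]; [:: 9; 12; 15; 20]; [:: 9; 12; 17; 20];
  [:: 9; 14; 16; 18]; [:: 9; 14; 17; 20]; [:: 9; 14; 18; 20];
  [:: 9; 15; 19; 20]; [:: 9; 16; 18; 20]; [:: 9; 16; 19; 20];
  [:: 10; 11; 17; 21]; [:: 10; 11; 18; 21]; [:: 10; 14; 17; 20];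
  [:: 10; 14; 17; 21]; [:: 10; 14; 20; 21]; [:: 10; 16; 19; 20];
  [:: 10; 17; 19; 20]; [:: 10; 18; 20; 21]; [:: 11; 12; 18; 21];
  [:: 11; 14; 15; 21]; [:: 11; 14; 16; 17]; [:: 11; 14; 17; 21];
  [:: 12; 13; 14; 15]; [:: 12; 13; 14; 21]; [:: 12; 13; 15; 20];
  [:: 12; 13; 16; 21]; [:: 12; 13; 17; 20]; [:: 12; 14; 15; 21];
  [:: 13; 17; 18; 19]; [:: 13; 17; 19; 20]].

(** * Exhaustive search for small transversals *)

(** Branching on the first of [k] vertices, with [b] choices left: taking it removes the edges
    through it, rejecting it shortens all edges. A branch is refuted when an edge is empty, or when
    edges remain and the vertices or the choices are used up. *)
Fixpoint transversals_exceed (k b : nat) (ts : seq bitseq) : bool :=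
  if has (fun t => ~~ has id t) ts then true else
  match k, b with
  | k'.+1, b'.+1 =>
      transversals_exceed k' b' [seq behead t | t <- ts & ~~ head false t] &&
      transversals_exceed k' b (map behead ts)
  | _, _ => ~~ nilp ts
  end.

Lemma transversals_exceedP k b ts (u : bitseq) : transversals_exceed k b ts ->
  size u = k ->
  (forall t, t \in ts -> exists2 i, nth false t i & nth false u i) ->
  b < count id u.
Proof.
elim: k b ts u => [|k IH] b ts u /=.
  case: ifP => [/hasP[t tts nt] _ _ h|_ ts0 /size0nil->]; last first.
    by case: ts ts0 => // t ts _ /(_ t (mem_head _ _)) [i]; rewrite nth_nil.
  case: (h t tts) => i ti _; case/negP: nt; apply/(has_nthP false).
  by exists i => //; case: ltnP => // hi; rewrite nth_default in ti.
have nhas t i : nth false t i -> has id t.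
  move=> ti; apply/(has_nthP false); exists i => //.
  by case: ltnP => // hi; rewrite nth_default in ti.
case: ifP => [/hasP[t tts nt] _ _ h|_].
  by case: (h t tts) => i /nhas; rewrite (negPf nt).
case: b => [|b].
  case: ts => // t ts _ _ /(_ t (mem_head _ _)) [i _ /nhas].
  by rewrite has_count.
move=> /andP[h1 h0]; case: u => // x u [su] h; case: x h => h /=; last first.
  apply: IH h0 su _ => _ /mapP[t tts ->]; case: (h t tts) => [[|i]] // ti ui.
  by exists i; rewrite // nth_behead.
rewrite add1n ltnS; apply: IH h1 su _ => s /mapP[t]; rewrite mem_filter.
case/andP=> ht tts ->; case: (h t tts) => [[|i]] ti ui.
  by move: ti ht; case: (t) => //= y t' ->.
by exists i; rewrite // nth_behead.
Qed.

(** * Properties of the ball checked by evaluation *)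

Definition code (n : nat) (s : seq nat) : bitseq := [seq i \in s | i <- iota 0 n].

(** Positions 5 to 21 are the 17 inner vertices. In [next_outer] position 21 takes the place of 4,
    because 21 = 4 + 17. *)
Definition outer := code 22 [:: 0; 1; 2; 4].
Definition ball_verts := code 22 (0 :: 1 :: 2 :: iota 4 18).
Definition next_outer := code 22 [:: 0; 1; 2; 21].
Definition core := map (code 22) core_facets.

(** A single evaluation runs all flips and checks the resulting list of faces; later arguments know
    [J] only through these properties. Core facets avoid the first five positions, so they use inner
    vertices only. *)
Lemma ball_exists : exists J : seq bitseq,
  [/\ forall g R, injective g ->
        (forall t, t \in R -> t `&` face g ball_verts `<` face g outer) ->
        is_complex (fill g R [:: outer]) ->
        is_complex (fill g R J) /\ PL_equiv (fill g R [:: outer]) (fill g R J),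
      forall c, c \in J -> size c = 22 /\ count id c <= 4,
      next_outer \in J &
      forall c, c \in core ->
        [/\ c \in J, ~~ has id (take 5 c) & count id c = 4]].
Proof.
have : (if flip_codes 22 outer ball_verts [:: outer]
    [seq (code 22 p.1, code 22 p.2) | p <- ball_flips] is Some J then
  [&& all (fun c => (size c == 22) && (count id c <= 4)) J, next_outer \in J &
      all (fun c => [&& c \in J, ~~ has id (take 5 c) & count id c == 4]) core]
  else false).
  by vm_compute.
case e: (flip_codes _ _ _ _ _) => [J|]; last by [].
have plJ := fun g R gI hR cK =>
  @flip_codes_PL 22 outer ball_verts g R _ [:: outer] J gI erefl erefl hR isT cK e.
move: plJ => {e} plJ /and3P[hJ nJ hcore]; exists J; split=> // c.
  by move=> /(allP hJ)/andP[/eqP].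
by move=> /(allP hcore)/and3P[-> -> /eqP].
Qed.

(** Source of the number 9: the search with 8 choices refutes every branch on the core facets, read
    on the 17 inner positions. *)
Lemma core_transversal (u : bitseq) : size u = 17 ->
  (forall c, c \in core -> exists2 i, nth false (drop 5 c) i & nth false u i) ->
  8 < count id u.
Proof.
move=> su h; apply: (@transversals_exceedP 17 8 (map (drop 5) core) u _ su).
  by vm_compute.
by move=> _ /mapP[c cc ->]; apply: h.
Qed.

(** * Gluing shifted copies of the ball *)

(* Copy number m of the ball keeps 0, 1, 2 and shifts the other vertices by 17 m,
   so that its outer tetrahedron is the tetrahedron next_outer of copy m - 1. *)
Definition shift (m j : nat) : nat := if j < 4 then j else (j + 17 * m)%N.

Lemma shift_inj m : injective (shift m).
Proof. by rewrite /shift => i j; case: (ltnP i 4); case: (ltnP j 4) => ? ? ?; lia. Qed.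

(** Only the tetrahedron itself is removed; its proper faces remain and bound the inserted ball. *)
Fixpoint chain (J : seq bitseq) (m : nat) : complex :=
  if m is k.+1 then fill (shift k) (chain J k `\ face (shift k) outer) J
  else simplex_boundary [fset 0; 1; 2; 3; 4].

Lemma face_code g n (s : seq nat) x : all (gtn n) s ->
  (x \in face g (code n s)) = (x \in map g s).
Proof.
move=> /allP sn; have nthc i : nth false (code n s) i = (i < n) && (i \in s).
  case: ltnP => h; last by rewrite nth_default ?size_map ?size_iota.
  by rewrite (nth_map 0) ?size_iota // nth_iota.
apply/faceP/mapP => -[i].
  by rewrite nthc => /andP[_ ?] ->; exists i.
by move=> si ->; exists i; rewrite // nthc si andbT; exact: sn.
Qed.

Lemma face_outerE m : face (shift m) outer = [fset 0; 1; 2; (4 + 17 * m)%N].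
Proof. by apply/fsetP => x; rewrite face_code // !inE -!orbA. Qed.

Lemma face_next_outer m : face (shift m) next_outer = face (shift m.+1) outer.
Proof.
apply/fsetP => x; rewrite [LHS]face_code // [RHS]face_code // /shift /= !inE.
by do 3 congr (_ || _); congr (x == _); lia.
Qed.

Lemma simplex_boundary_complex (S : {fset nat}) : is_complex (simplex_boundary S).
Proof.
split=> [|s t]; first by rewrite !inE eqxx andbF.
rewrite !inE !fpowersetE => /and3P[sS s0 snS] ts t0; rewrite t0 (fsubset_trans ts sS) /=.
apply: contra snS => /eqP e; by rewrite eqEfsubset sS -e.
Qed.

Lemma card_fset5 : #|` [fset 0; 1; 2; 3; 4]| = 5.
Proof.
have -> : [fset 0; 1; 2; 3; 4] = [fset x in iota 0 5].
  by apply/fsetP => x; rewrite [RHS]in_fset /= !inE -!orbA.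
by rewrite card_fseq undup_id ?iota_uniq.
Qed.

(** * Facets and transversals *)

Lemma mem_facets (K : complex) (s : {fset nat}) :
  reflect (s \in K /\ forall t : {fset nat}, t \in K -> s `<=` t -> t = s)
          (s \in facets K).
Proof.
rewrite !inE /=; apply: (iffP andP) => -[sK h]; split=> //.
  by move=> t tK st; move/forallP: h => /(_ [` tK]) /implyP/(_ st)/eqP.
by apply/forallP => t; apply/implyP => /h ->; rewrite ?fsvalP.
Qed.

Lemma transversalP (K : complex) (T : {fset nat}) :
  reflect (forall F, F \in facets K -> exists2 x, x \in T & x \in F)
          (Defs.is_transversal K T).
Proof.
apply: (iffP forallP) => h F.
  move=> FK; have /fset0Pn[x] := h [` FK].
  by rewrite in_fsetI => /andP[]; exists x.
have [x xT xF] := h _ (fsvalP F).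
by apply/fset0Pn; exists x; rewrite in_fsetI xT.
Qed.

(** Facets are nonempty since [fset0] is not a face. This covers the default value of the minimum in
    [tau_facets]. *)
Lemma verts_transversal (K : complex) : is_complex K -> Defs.is_transversal K (verts K).
Proof.
move=> [K0 _]; apply/transversalP => F /mem_facets[FK _].
have /fset0Pn[x xF] : F != fset0 by apply: contraNneq K0 => <-.
by exists x; rewrite // (in_verts FK).
Qed.

Lemma tau_facets_ge (K : complex) (a : nat) : is_complex K ->
  (forall T, Defs.is_transversal K T -> a <= #|` T|) -> a <= tau_facets K.
Proof.
move=> cK h; rewrite /tau_facets; apply: (big_ind (leq a)).
- exact/h/verts_transversal.
- by move=> x y; rewrite leq_min => -> ->.
- by move=> T /h.
Qed.

(** * Invariants of the chain *)

(** Inner positions of copy [m] receive labels from 5 + 17m on, so only the vertices of the outer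
    tetrahedron can be old. *)
Lemma ball_verts_old m x : (x < 5 + 17 * m)%N ->
  x \in face (shift m) ball_verts -> x \in face (shift m) outer.
Proof.
move=> xm /faceP[j jU ex]; apply/faceP; exists j; last exact: ex.
have j5 : j < 5 by move: xm; rewrite ex /shift; case: (ltnP j 4); lia.
by move: jU; rewrite {xm ex}; move: j j5; do 5 case=> //.
Qed.

(** Induction on [m]: the bound on labels makes inner vertices new, and the bound 4 on cardinalities
    makes the tetrahedron to be filled maximal. Together they give the condition on [R] under which
    the flips are valid. *)
Lemma chain_spec (J : seq bitseq) m :
  (forall g R, injective g ->
    (forall t, t \in R -> t `&` face g ball_verts `<` face g outer) ->
    is_complex (fill g R [:: outer]) ->
    is_complex (fill g R J) /\ PL_equiv (fill g R [:: outer]) (fill g R J)) ->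
  (forall c, c \in J -> size c = 22 /\ count id c <= 4) -> next_outer \in J ->
  (forall c, c \in core ->
    [/\ c \in J, ~~ has id (take 5 c) & count id c = 4]) ->
  let K := chain J m in
  [/\ is_complex K /\ PL_equiv K (chain J 0),
      forall t, t \in K -> {in t, forall x, x < 5 + 17 * m}%N,
      forall t, t \in K -> #|` t| <= 4,
      face (shift m) outer \in K &
      forall i c, i < m -> c \in core -> face (shift i) c \in K].
Proof.
move=> plJ cJ nJ hcore; elim: m => [|m [[cK eK] bK dK oK coreK]] /=.
  split=> //.
  - by split; [exact: simplex_boundary_complex | exact: rst_refl].
  - move=> t; rewrite !inE fpowersetE => /andP[/fsubsetP tS _] x /tS.
    by rewrite !inE => /orP[/orP[/orP[/orP[]|]|]|] /eqP->.
  - move=> t; rewrite !inE fpowersetE => /and3P[tS _ tnS].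
    by rewrite -ltnS -card_fset5; apply: fproper_ltn_card; rewrite fproperEneq tnS.
  - rewrite face_outerE !inE fpowersetE; apply/and3P; split.
    + by apply/fsubsetP => x; rewrite !inE => /orP[/orP[/orP[]|]|] ->; rewrite ?orbT.
    + by apply/fset0Pn; exists 0; rewrite !inE.
    + by apply/negP => /eqP/fsetP/(_ 3); rewrite !inE.
set R := chain J m `\ face (shift m) outer.
have gI := @shift_inj m.
have RK t : t \in R -> t \in chain J m by rewrite in_fsetD1 => /andP[].
(* The flips start from the trivial filling, which puts the removed tetrahedron back. *)
have e0 : fill (shift m) R [:: outer] = chain J m.
  apply/fsetP => t; apply/fillP/idP => [[/RK//|[c]]|tK].
    by rewrite inE => /eqP-> ->.
  case: (eqVneq t (face (shift m) outer)) => [->|tn]; last first.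
    by left; rewrite in_fsetD1 tn.
  by right; exists outer; rewrite ?inE.
have card_outer : #|` face (shift m) outer| = 4 by rewrite card_face.
have hR t : t \in R ->
    t `&` face (shift m) ball_verts `<` face (shift m) outer.
  rewrite in_fsetD1 => /andP[tn tK]; rewrite fproperE; apply/andP; split.
    apply/fsubsetP => x; rewrite in_fsetI => /andP[/(bK _ tK)].
    exact: ball_verts_old.
  (* A face containing the whole tetrahedron equals it by cardinality, but it was removed. *)
  apply: contra tn; rewrite fsubsetI => /andP[ot _].
  by rewrite eq_sym eqEfcard ot card_outer dK.
have [] := plJ _ _ gI hR; first by rewrite e0.
rewrite e0 => cK' eK'.
have K'P t : t \in fill (shift m) R J ->
    t \in chain J m \/ exists2 c, c \in J & t = face (shift m) c.
  by case/fillP => [/RK|]; [left | right].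
split=> //.
- split=> //; apply: rst_trans eK; apply: rst_sym; exact: eK'.
- move=> t /K'P[tK|[c cc ->]] x; first by move/(bK t tK); lia.
  case/faceP => j cj ->; have : j < 22.
    case: (cJ c cc) => <- _; case: ltnP => // h.
    by rewrite nth_default in cj.
  by rewrite /shift; case: (ltnP j 4); lia.
- move=> t /K'P[/dK//|[c cc ->]]; rewrite card_face //.
  by case: (cJ c cc).
- rewrite -face_next_outer; apply/fillP; right; by exists next_outer.
move=> i c; rewrite ltnS leq_eqVlt => /orP[/eqP->|im] cc; apply/fillP.
  by right; exists c => //; case: (hcore c cc).
(* Older core facets survive the removal: the tetrahedron contains vertex 0, whose only position is
   0, and core facets avoid that position. *)
left; rewrite in_fsetD1 coreK // andbT; apply/eqP => e.
have : 0 \in face (shift i) c by rewrite e face_outerE !inE.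
case/faceP => j cj; rewrite /shift; case: (ltnP j 4) => [_ j0|]; last by lia.
have {j0} cj0 : nth false c 0 by rewrite j0.
by case: (hcore c cc) => _ /negP[]; case: (c) cj0 => //= y c' ->.
Qed.

(** * Counting over the copies *)

(** The core of copy [i] lives on the 17 labels starting at 5 + 17i. These blocks are disjoint, and
    each contains at least nine elements of [T]. *)
Lemma hitting_core_count (T : {fset nat}) m :
  (forall c, c \in core -> ~~ has id (take 5 c)) ->
  (forall i c, i < m -> c \in core -> exists2 x, x \in T & x \in face (shift i) c) ->
  9 * m <= #|` T|.
Proof.
move=> c5 hT.
apply: (@leq_trans (count (mem T) (iota 0 (5 + 17 * m)))); last first.
  rewrite -size_filter uniq_leq_size ?filter_uniq ?iota_uniq // => x.
  by rewrite mem_filter => /andP[].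
elim: m hT => // m IH hT.
rewrite mulnS addnC (_ : 5 + 17 * m.+1 = 5 + 17 * m + 17)%N; last by lia.
rewrite iotaD count_cat add0n leq_add ?IH // => [i c im|]; first exact/hT/ltnW.
pose u := [seq x \in T | x <- iota (5 + 17 * m) 17].
have -> : count (mem T) (iota (5 + 17 * m) 17) = count id u by rewrite count_map.
apply: core_transversal => [|c cc]; first by rewrite size_map size_iota.
have [x xT /faceP[i ci ex]] := hT m c (ltnSn m) cc.
have i5 : 5 <= i.
  rewrite leqNgt; apply: contra (c5 c cc) => i5; apply/(has_nthP false).
  exists i; last by rewrite nth_take.
  rewrite size_take; case: ifP => // _; case: ltnP => // h.
  by rewrite nth_default in ci.
(* Position [i] of the ball is entry [i - 5] of the block [u]. *)
exists (i - 5); first by rewrite nth_drop subnKC.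
have i22 : i < 22.
  case/mapP: cc ci => t _ ->; case: ltnP => // h.
  by rewrite nth_default // size_map size_iota.
rewrite (nth_map 0) ?size_iota ?nth_iota; try lia.
rewrite (_ : 5 + 17 * m + (i - 5) = x)%N //.
by rewrite ex /shift; case: (ltnP i 4); lia.
Qed.

Theorem theorem1p3 :
  forall N : nat, exists K : complex,
    PL_sphere 3 K /\ N <= #|` verts K| /\
    11 * #|` verts K| <= 21 * tau_facets K.
Proof.
move=> N; have [J [plJ cJ nJ hcore]] := ball_exists.
(* The inequality 11(5 + 17m) <= 21 * 9m amounts to 55 <= 2m, that is m >= 28; adding [N] gives
   enough vertices. *)
pose m := (N + 28)%N; exists (chain J m).
have [[cK eK] bK dK _ coreK] := chain_spec m plJ cJ nJ hcore.
have hT T : Defs.is_transversal (chain J m) T -> 9 * m <= #|` T|.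
  move=> /transversalP tT; apply: hitting_core_count => //.
    by move=> c /hcore[].
  move=> i c im cc; apply: tT; apply/mem_facets; split; first exact: coreK.
  (* A core face has four vertices and no face has more, so it is a facet. *)
  move=> t tK ct; apply/eqP; rewrite eq_sym eqEfcard ct card_face; last exact: shift_inj.
  by case: (hcore c cc) => _ _ ->; apply: dK.
have tau : 9 * m <= tau_facets (chain J m) by apply: tau_facets_ge.
(* The vertex set is itself a transversal, so there are at least 9m >= N vertices. *)
have vlo := hT _ (verts_transversal cK).
have vhi : #|` verts (chain J m)| <= 5 + 17 * m.
  rewrite -(size_iota 0 (5 + 17 * m)%N) uniq_leq_size // => x.
  by case/bigfcupP => t /andP[tK _] /(bK t tK); rewrite mem_iota.
split; last by split; lia.
split=> //; exists [fset 0; 1; 2; 3; 4]; split; [exact: card_fset5 | exact: eK].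
Qed.
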